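(* Let $k\in\mathbb{N}$ and let $p$ be a prime number. The ordinary generating function of $Z_k(p)$ is rational and is given, for $|t|\le p$, by $$\mathbb{E}\,t^{Z_k(p)}=\left(1-\frac1p\right)^{k}\left(1-\frac tp\right)^{-k}\sum_{j=1}^{k}\binom kj(-1)^{j-1}\frac{1-\left(\frac tp\right)^{j}}{1-\frac{t^{j-1}}{p^{j}}}$$ (at $t=p$ the right-hand side is understood by continuous extension). In particular, $\mathbb{E}\,t^{Z_1(p)}=1$, as well as $$\mathbb{E}\,t^{Z_2(p)}=\mathbb{E}\,t^{\min(\mathcal{G}_1(p),\mathcal{G}_2(p))}=\frac{1-\frac1{p^2}}{1-\frac t{p^2}},$$ $$\mathbb{E}\,t^{Z_3(p)}=\frac{\left(1-\frac1p\right)^2}{\left(1-\frac{t}{p^2}\right)\left(1-\frac{t^2}{p^3}\right)}\left(1+\frac2p+\frac{2t}{p^2}+\frac{t}{p^3}\right).$$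
   Context: $\mathbb{N}=\{1,2,3,\ldots\}$ and $\mathbb{N}_0=\mathbb{N}\cup\{0\}$. For a prime $p$, $\mathcal{G}_1(p),\mathcal{G}_2(p),\ldots,\mathcal{G}_k(p)$ are independent random variables with $\mathbb{P}\{\mathcal{G}_j(p)=i\}=\left(1-\frac1p\right)\frac1{p^{i}}$ for $i\in\mathbb{N}_0$, and $$Z_k(p)=\sum_{j=1}^{k}\mathcal{G}_j(p)-\max_{1\le j\le k}\mathcal{G}_j(p).$$ The convention $t^0=1$ is used, including at $t=0$. *)

(* Defs.v *)
From HB Require Import structures.
From mathcomp Require Import all_boot all_order all_algebra.
From mathcomp Require Import all_classical all_reals all_analysis.
From mathcomp Require Import complex.

Set Implicit Arguments.
Unset Strict Implicit.
Unset Printing Implicit Defensive.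

Import Order.TTheory GRing.Theory Num.Theory.
Import numFieldNormedType.Exports.

Local Open Scope classical_set_scope.
Local Open Scope ring_scope.
Local Open Scope complex_scope.

Definition mutually_independent d d' (T : measurableType d)
    (U : measurableType d') (R : realType) (P : probability T R)
    (I : finType) (X : I -> {RV P >-> U}) : Prop :=
  forall (J : {set I}) (A : I -> set U), (forall j, measurable (A j)) ->
    P (\bigcap_(j in [set j | j \in J]) (X j @^-1` A j)) =
    (\prod_(j in J) P (X j @^-1` A j))%E.

Definition geometric d (T : measurableType d) (R : realType)
    (P : probability T R) (p : nat) (X : {RV P >-> nat}) : Prop :=
  forall i : nat,
    P (X @^-1` [set i]) = ((1 - 1 / p%:R) * (1 / p%:R ^+ i))%:E.

Definition iid_geometric d (T : measurableType d) (R : realType)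
    (P : probability T R) (p k : nat) (G : 'I_k -> {RV P >-> nat}) : Prop :=
  mutually_independent G /\ forall j, geometric p (G j).

(* The truncated subtraction is exact, as the maximum is at most the sum. *)
Definition Zk d (T : measurableType d) (R : realType) (P : probability T R)
    (k : nat) (G : 'I_k -> {RV P >-> nat}) (w : T) : nat :=
  (\sum_(j < k) G j w - \max_(j < k) G j w)%N.

(* The library integrates only real-valued functions, so expectations of
   complex-valued functions are taken componentwise. *)
Definition Cintegrable d (T : measurableType d) (R : realType)
    (P : probability T R) (f : T -> R[i]) : Prop :=
  P.-integrable [set: T] (EFin \o (fun w => complex.Re (f w))) /\
  P.-integrable [set: T] (EFin \o (fun w => complex.Im (f w))).

Definition Cexpectation d (T : measurableType d) (R : realType)
    (P : probability T R) (f : T -> R[i]) : R[i] :=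
  fine ('E_P[fun w => complex.Re (f w)]) +i*
  fine ('E_P[fun w => complex.Im (f w)]).

Definition genfun d (T : measurableType d) (R : realType)
    (P : probability T R) (X : T -> nat) (t : R[i]) : R[i] :=
  Cexpectation P (fun w => t ^+ X w).

(* Division by zero yields 0 here, so the value at t = p is meaningless. *)
Definition Zgf_formula (R : realType) (p k : nat) (t : R[i]) : R[i] :=
  (1 - 1 / p%:R) ^+ k * (1 - t / p%:R) ^- k *
  \sum_(1 <= j < k.+1)
    'C(k, j)%:R * (-1) ^+ (j - 1) *
    ((1 - (t / p%:R) ^+ j) / (1 - t ^+ (j - 1) / p%:R ^+ j)).

(* Main.v *)
(* With N_i the number of j such that G_j >= i, one has
     sum_j G_j - max_j G_j = sum_(i >= 1) max(N_i - 1, 0),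
   and given N_i the variable N_(i+1) is binomial with success probability
   q = 1/p. Conditioning on N_1 shows that F_k(t) = E t^(Z_k) solves the
   triangular recurrence
     F_k = (1-q)^k + sum_(1 <= n <= k) C(k,n) q^n (1-q)^(k-n) t^(n-1) F_n,
   whose diagonal coefficient q^k t^(k-1) has norm at most q for |t| <= p.
   Hence the solution is unique and rational, with denominator
   prod_(1 <= j <= k) (1 - q^j t^(j-1)), and binomial inversion shows that the
   closed formula solves it when t <> p.
   To avoid conditioning, the G_j are replaced by min(G_j, m), which take
   finitely many values: their generating functions are the m-th iterates of
   the recurrence started at 1, which converge geometrically to its solution.
   Monotone convergence at t = p makes p^(Z_k) integrable, and it dominates
   t^(Z_k^(m)) for |t| <= p. *)

Require Import Defs.
From mathcomp Require Import all_boot all_order all_algebra.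
From mathcomp Require Import all_classical all_reals all_analysis.
From mathcomp Require Import complex.
From mathcomp Require Import measurable_realfun.
From mathcomp Require Import ring zify.

Set Implicit Arguments.
Unset Strict Implicit.
Unset Printing Implicit Defensive.

Import Order.TTheory GRing.Theory Num.Theory.
Import numFieldNormedType.Exports.

Local Open Scope classical_set_scope.
Local Open Scope ring_scope.
Local Open Scope complex_scope.

(** * The recurrence *)

Definition gf_step (K : fieldType) (q t : K) (f : nat -> K) (n : nat) : K :=
  (1 - q) ^+ n + \sum_(1 <= j < n.+1)
    'C(n, j)%:R * q ^+ j * (1 - q) ^+ (n - j) * t ^+ (j - 1) * f j.

(** The bound [k] lets solutions exist wherever the finitely many diagonal factors 1 - q^j t^(j-1),
    j <= k, do not vanish. *)
Definition gf_fixpoint (K : fieldType) (q t : K) (k : nat) (f : nat -> K) :=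
  forall n, (0 < n <= k)%N -> f n = gf_step q t f n.

Definition gf_closed (K : fieldType) (q t : K) (n : nat) : K :=
  (1 - q) ^+ n * (1 - q * t) ^- n * \sum_(1 <= j < n.+1)
    'C(n, j)%:R * (-1) ^+ (j - 1) *
    ((1 - (q * t) ^+ j) / (1 - q ^+ j * t ^+ (j - 1))).

Section Recurrence.
Variable K : fieldType.
Implicit Types (q t : K) (f : nat -> K).

(** Isolates the diagonal term, the only one on the right that involves [f n.+1]: the system is
    triangular. *)
Lemma gf_step_last q t f n :
  gf_step q t f n.+1 = (1 - q) ^+ n.+1 +
    \sum_(1 <= j < n.+1) 'C(n.+1, j)%:R * q ^+ j * (1 - q) ^+ (n.+1 - j)
      * t ^+ (j - 1) * f j + q ^+ n.+1 * t ^+ n * f n.+1.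
Proof.
by rewrite /gf_step big_nat_recr //= binn subnn subn1 expr0 mulr1 mul1r addrA.
Qed.

(** Strong induction: once the lower values agree, the difference at n is annihilated by 1 - q^n
    t^(n-1), which is nonzero. *)
Lemma gf_fixpoint_unique q t k f g :
  (forall j, (0 < j <= k)%N -> q ^+ j * t ^+ (j - 1) != 1) ->
  gf_fixpoint q t k f -> gf_fixpoint q t k g ->
  forall n, (0 < n <= k)%N -> f n = g n.
Proof.
move=> qt1 ff fg; elim/ltn_ind => -[//|n] IH /andP[_ nk].
have := ff n.+1 nk; have := fg n.+1 nk.
rewrite !gf_step_last => eg ef.
have := qt1 n.+1 nk; rewrite subn1 /= => /negPf ne1.
apply/eqP.
have : (f n.+1 - g n.+1) * (1 - q ^+ n.+1 * t ^+ n) = 0.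
  rewrite mulrBr mulr1 {1}ef {1}eg.
  have -> : \sum_(1 <= j < n.+1) 'C(n.+1, j)%:R * q ^+ j *
      (1 - q) ^+ (n.+1 - j) * t ^+ (j - 1) * f j =
    \sum_(1 <= j < n.+1) 'C(n.+1, j)%:R * q ^+ j *
      (1 - q) ^+ (n.+1 - j) * t ^+ (j - 1) * g j.
    apply: eq_big_nat => j /andP[j0 jn]; rewrite IH // j0 /=.
    exact: leq_trans (ltnW jn) nk.
  by ring.
by move/eqP; rewrite mulf_eq0 !subr_eq0 (eq_sym 1) ne1 orbF.
Qed.

(** Multiplied by j! (n-j)! (k-n)!, both sides become k!. *)
Lemma bin_mul_bin k n j : (j <= n <= k)%N ->
  ('C(k, n) * 'C(n, j) = 'C(k, j) * 'C(k - j, n - j))%N.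
Proof.
move=> /andP[jn nk]; have jk := leq_trans jn nk.
have p1 := bin_fact nk; have p2 := bin_fact jn; have p3 := bin_fact jk.
have p4 : ('C(k - j, n - j) * ((n - j)`! * (k - n)`!) = (k - j)`!)%N.
  have -> : (k - n = (k - j) - (n - j))%N by lia.
  by apply: bin_fact; lia.
have h : (0 < j`! * (n - j)`! * (k - n)`!)%N by rewrite !muln_gt0 !fact_gt0.
apply/eqP; rewrite -(eqn_pmul2r h); apply/eqP.
transitivity k`!.
  by rewrite -p1 -p2; ring.
by rewrite -p3 -p4; ring.
Qed.

Lemma sum_bin_bin (x y : K) k j : (j <= k)%N ->
  \sum_(j <= n < k.+1) 'C(k, n)%:R * 'C(n, j)%:R * y ^+ (k - n) * x ^+ (n - j)
  = 'C(k, j)%:R * (y + x) ^+ (k - j).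
Proof.
move=> jk; rewrite exprDn mulr_sumr -{1}(add0n j) big_addn big_mkord.
rewrite subSn //; apply: eq_bigr => i _.
have le : (j <= i + j <= k)%N by have := ltn_ord i; lia.
rewrite -natrM bin_mul_bin // addnK natrM.
have -> : (k - (i + j) = k - j - i)%N by lia.
by rewrite -mulr_natl; ring.
Qed.

(** The binomial expansion of (1 - x)^k with its constant term moved across and the signs
    reversed. *)
Lemma sum_bin_sign (x : K) k :
  \sum_(1 <= j < k.+1) 'C(k, j)%:R * (-1) ^+ (j - 1) * x ^+ j
  = 1 - (1 - x) ^+ k.
Proof.
rewrite exprBn big_ord_recl /= bin0 expr0 !expr1n mulr1 !mul1r mulr1n.
rewrite opprD addrA subrr add0r big_add1 big_mkord /= -sumrN.
apply: eq_bigr => i _; rewrite subn1 /= /bump /= add1n expr1n mulr1 -[(_ * x ^+ _) *+ _]mulr_natl !exprS.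
by ring.
Qed.

Lemma gf_closed_fixpoint q t k : 1 - q != 0 -> 1 - q * t != 0 ->
  (forall j, (0 < j <= k)%N -> q ^+ j * t ^+ (j - 1) != 1) ->
  gf_fixpoint q t k (gf_closed q t).
Proof.
move=> q1 x1 qt1 k' /andP[k'0 k'k].
have {}qt1 j : (0 < j <= k')%N -> 1 - q ^+ j * t ^+ (j - 1) != 0.
  by move=> ?; rewrite subr_eq0 eq_sym qt1 //; lia.
move: k' k'0 qt1 {k'k k} => k k0 qt1.
set x := q * t in x1 *.
pose a j := (1 - x ^+ j) / (1 - q ^+ j * t ^+ (j - 1)).
pose s j : K := (-1) ^+ (j - 1).
pose H n := \sum_(1 <= j < n.+1) 'C(n, j)%:R * s j * a j.
have closedE n : gf_closed q t n = (1 - q) ^+ n * (1 - x) ^- n * H n by [].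
(* Dividing the recurrence by ((1 - q) / (1 - x))^k turns it into one for the binomial transform H
   of s_j a_j. *)
suff key : H k = (1 - x) ^+ k + \sum_(1 <= n < k.+1)
    'C(k, n)%:R * (1 - x) ^+ (k - n) * (q ^+ n * t ^+ (n - 1)) * H n.
  rewrite closedE key /gf_step mulrDr; congr (_ + _).
    by rewrite -mulrA mulVf ?mulr1 // expf_neq0.
  rewrite mulr_sumr; apply: eq_big_nat => n /andP[n0 nk].
  rewrite closedE -(subnK (ltnSE nk)) addnK !exprD.
  by field; rewrite !expf_neq0.
(* Expand H n and exchange the sums. As q^n t^(n-1) = q^j t^(j-1) x^(n-j), the inner sum over n is
   C(k,j) ((1 - x) + x)^(k-j) = C(k,j). *)
have -> : \sum_(1 <= n < k.+1)
    'C(k, n)%:R * (1 - x) ^+ (k - n) * (q ^+ n * t ^+ (n - 1)) * H n =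
  \sum_(1 <= j < k.+1) s j * a j * (q ^+ j * t ^+ (j - 1)) * 'C(k, j)%:R.
  transitivity (\sum_(1 <= n < k.+1) \sum_(1 <= j < k.+1 | (j <= n)%N)
     s j * a j * (q ^+ j * t ^+ (j - 1)) *
     ('C(k, n)%:R * 'C(n, j)%:R * (1 - x) ^+ (k - n) * x ^+ (n - j))).
    apply: eq_big_nat => n /andP[n0 nk].
    rewrite /H mulr_sumr (big_nat_widen _ _ k.+1) //.
    rewrite big_nat_cond [RHS]big_nat_cond; apply: eq_big => [j|j]; first by lia.
    move=> /andP[/andP[j0 _] jn].
    have -> : q ^+ n * t ^+ (n - 1) = q ^+ j * t ^+ (j - 1) * x ^+ (n - j).
      have {1}-> : n = (n - j + j)%N by lia.
      have -> : (n - 1 = n - j + (j - 1))%N by lia.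
      by rewrite !exprD /x exprMn; ring.
    by ring.
  rewrite (exchange_big_dep predT) //=; apply: eq_big_nat => j /andP[j0 jk].
  rewrite -mulr_sumr; congr (_ * _).
  transitivity (\sum_(j <= n < k.+1) 'C(k, n)%:R * 'C(n, j)%:R *
     (1 - x) ^+ (k - n) * x ^+ (n - j)).
    by rewrite (big_nat_widenl j 1).
  by rewrite sum_bin_bin // subrK expr1n mulr1.
(* The terms now combine to a_j (1 - q^j t^(j-1)) = 1 - x^j, which clears the denominators. What
   remains is [sum_bin_sign] at 1 and at x; at 1 it gives 1 because 0^k = 0 for k > 0. *)
apply/eqP; rewrite -subr_eq /H -sumrB.
have -> : \sum_(1 <= j < k.+1) ('C(k, j)%:R * s j * a j -
    s j * a j * (q ^+ j * t ^+ (j - 1)) * 'C(k, j)%:R) =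
  \sum_(1 <= j < k.+1) 'C(k, j)%:R * (-1) ^+ (j - 1) * 1 ^+ j -
  \sum_(1 <= j < k.+1) 'C(k, j)%:R * (-1) ^+ (j - 1) * x ^+ j.
  rewrite -sumrB; apply: eq_big_nat => j jk.
  rewrite expr1n /a /s.
  by field; exact: qt1.
rewrite !sum_bin_sign subrr expr0n; case: k k0 {qt1 H closedE} => //= k _.
by apply/eqP; ring.
Qed.

Lemma gf_fixpoint1 q t k f : (0 < k)%N -> 1 - q != 0 ->
  gf_fixpoint q t k f -> f 1%N = 1.
Proof.
move=> k0 q1 /(_ 1%N k0).
rewrite gf_step_last big_geq // addr0 !expr1 expr0 mulr1 => e.
by apply: (mulfI q1); rewrite mulr1 mulrBl mul1r {1}e addrK.
Qed.

Lemma gf_fixpoint2 q t k f : (1 < k)%N -> 1 - q != 0 ->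
  1 - q ^+ 2 * t != 0 -> gf_fixpoint q t k f ->
  f 2%N = (1 - q ^+ 2) / (1 - q ^+ 2 * t).
Proof.
move=> k1 q1 d2 ff; have := ff 2%N k1.
rewrite gf_step_last big_nat1 (gf_fixpoint1 (ltnW k1) q1 ff) bin1 expr1 expr0 => e.
by apply: (mulIf d2); rewrite divfK // mulrBr mulr1 {1}e; ring.
Qed.

Lemma gf_fixpoint3 q t k f : (2 < k)%N -> 1 - q != 0 ->
  1 - q ^+ 2 * t != 0 -> 1 - q ^+ 3 * t ^+ 2 != 0 -> gf_fixpoint q t k f ->
  f 3%N = (1 - q) ^+ 2 / ((1 - q ^+ 2 * t) * (1 - q ^+ 3 * t ^+ 2)) *
    (1 + 2 * q + 2 * q ^+ 2 * t + q ^+ 3 * t).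
Proof.
move=> k2 q1 d2 d3 ff; have := ff 3%N k2.
rewrite gf_step_last big_nat_recr //= big_nat1.
rewrite (gf_fixpoint2 (ltnW k2) q1 d2 ff) (gf_fixpoint1 (ltnW (ltnW k2)) q1 ff).
rewrite bin1 (_ : 'C(3, 2) = 3%N) // expr1 expr0 => e.
apply: (mulIf d3); rewrite mulrBr mulr1 {1}e.
by field; rewrite d2 d3.
Qed.

(** * Rationality of the solution *)

Definition gf_den (k : nat) (q : K) : {poly K} :=
  \prod_(1 <= j < k.+1) (1 - q ^+ j *: 'X^(j - 1)).

Lemma gf_den_neq0 q t k : (gf_den k q).[t] != 0 <->
  (forall j, (0 < j <= k)%N -> q ^+ j * t ^+ (j - 1) != 1).
Proof.
rewrite /gf_den horner_prod prodf_seq_neq0; split=> [/allP h j jk|h].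
  have := h j; rewrite mem_index_iota ltnS => /(_ jk).
  by rewrite /= !hornerE subr_eq0 eq_sym.
apply/allP => j; rewrite mem_index_iota ltnS => jk /=.
by rewrite !hornerE subr_eq0 eq_sym h.
Qed.

(** Induction on k: solving the last equation for its diagonal term divides by just one new factor
    of [gf_den]. The numerators do not depend on t. *)
Lemma gf_fixpoint_rational q k : exists A : nat -> {poly K}, forall t,
  (gf_den k q).[t] != 0 ->
  gf_fixpoint q t k (fun n => (A n).[t] / (gf_den n q).[t]).
Proof.
elim: k => [|k [A IH]].
  by exists (fun=> 0) => t _ n; case: n => // n /andP[].
(* The cofactor of [gf_den j q] in [gf_den k q], which brings the j-th term to the common
   denominator. *)
pose D j := \prod_(j.+1 <= i < k.+1) (1 - q ^+ i *: 'X^(i - 1) : {poly K}).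
pose N := ((1 - q) ^+ k.+1) *: gf_den k q + \sum_(1 <= j < k.+1)
  ('C(k.+1, j)%:R * q ^+ j * (1 - q) ^+ (k.+1 - j)) *: ('X^(j - 1) * A j * D j).
exists (fun n => if n == k.+1 then N else A n) => t den0.
have denS : gf_den k.+1 q = gf_den k q * (1 - q ^+ k.+1 *: 'X^k).
  by rewrite /gf_den big_nat_recr //= subn1.
have [d1 d2] : (gf_den k q).[t] != 0 /\ 1 - q ^+ k.+1 * t ^+ k != 0.
  by move: den0; rewrite denS !hornerE mulf_eq0 negb_or => /andP.
move=> n /andP[n0]; rewrite leq_eqVlt ltnS => /orP[/eqP->|nk].
  rewrite gf_step_last eqxx.
  set S := \sum_(1 <= j < k.+1) _.
  suff -> : N.[t] = ((1 - q) ^+ k.+1 + S) * (gf_den k q).[t].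
    have e : (1 - q ^+ k.+1 *: 'X^k).[t] = 1 - q ^+ k.+1 * t ^+ k.
      by rewrite !hornerE.
    by rewrite denS hornerM e; field; rewrite d1 d2.
  rewrite /N hornerD hornerZ mulrDl; congr (_ + _).
  rewrite horner_sum /S mulr_suml; apply: eq_big_nat => j /andP[j0 jk].
  have -> : gf_den k q = gf_den j q * D j.
    by rewrite /gf_den /D (@big_cat_nat _ _ _ j.+1) // ltnS ltnW.
  have dj : (gf_den j q).[t] != 0.
    apply/gf_den_neq0 => i ij; move/gf_den_neq0: d1; apply; lia.
  rewrite (_ : (j == k.+1) = false) ?hornerZ ?hornerM ?hornerXn; last by lia.
  by field.
rewrite (_ : (n == k.+1) = false); last by lia.
rewrite (IH t d1) ?n0 //; congr (_ + _); apply: eq_big_nat => j /andP[_ jn].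
by rewrite (_ : (j == k.+1) = false) //; lia.
Qed.

End Recurrence.

(** Induction on k. The diagonal coefficient q (q t)^k contracts the error by q < r, and the lower
    indices feed in an error that already decays like r^m. *)
Lemma gf_iter_cvg (K : numFieldType) (q r t : K) (k : nat) (f : nat -> K) :
  0 <= q -> q < r -> `|q * t| <= 1 -> gf_fixpoint q t k f ->
  exists2 C, 0 <= C & forall m n, (0 < n <= k)%N ->
    `|iter m (gf_step q t) (fun=> 1) n - f n| <= C * r ^+ m.
Proof.
move=> q0 qr qt1; have r0 : 0 < r := le_lt_trans q0 qr.
elim: k => [_|k IH ff]; first by exists 0 => // m [].
have [|C C0 {}IH] := IH.
  by move=> n /andP[n0 nk]; apply: ff; rewrite n0 ltnW.
pose c j := `|'C(k.+1, j)%:R * q ^+ j * (1 - q) ^+ (k.+1 - j) * t ^+ (j - 1)|.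
pose D := \sum_(1 <= j < k.+1) c j * C.
have D0 : 0 <= D by apply: sumr_ge0 => j _; rewrite mulr_ge0 // normr_ge0.
have rq : 0 < r - q by rewrite subr_gt0.
(* The three summands cover the lower indices, the starting error at m = 0, and the inflow from
   below: D <= (r - q) C' gives D r^m + q C' r^m <= C' r^(m+1). *)
pose C' := C + `|1 - f k.+1| + D / (r - q).
have C'0 : 0 <= C' by rewrite !addr_ge0 // divr_ge0 // ltW.
exists C' => // m n /andP[n0]; rewrite leq_eqVlt ltnS => /orP[/eqP->|nk]; last first.
  apply: le_trans (IH m n _) _; first by rewrite n0.
  by rewrite ler_wpM2r ?exprn_ge0 ?(ltW r0) // /C' -addrA lerDl addr_ge0 // divr_ge0 // ltW.
elim: m => [|m IHm].
  by rewrite /= expr0 mulr1 /C' addrAC lerDr addr_ge0 // divr_ge0 // ltW.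
rewrite iterS [f _]ff ?leqnn // !gf_step_last.
set F := iter m _ _ in IHm *.
rewrite (_ : _ - _ = \sum_(1 <= j < k.+1) ('C(k.+1, j)%:R * q ^+ j *
   (1 - q) ^+ (k.+1 - j) * t ^+ (j - 1)) * (F j - f j) +
   q * (q * t) ^+ k * (F k.+1 - f k.+1)); last first.
  rewrite (eq_bigr _ (fun j _ => mulrBr _ _ _)) sumrB exprMn [q ^+ k.+1]exprS.
  by ring.
apply: le_trans (ler_normD _ _) _.
have -> : C' * r ^+ m.+1 = (r - q) * C' * r ^+ m + q * (C' * r ^+ m).
  by rewrite exprS; ring.
apply: lerD.
  apply: (@le_trans _ _ (D * r ^+ m)).
    rewrite /D mulr_suml; apply: le_trans (ler_norm_sum _ _ _) _.
    rewrite big_nat_cond [leRHS]big_nat_cond; apply: ler_sum => j /andP[jk _].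
    by rewrite normrM -/(c j) -mulrA ler_wpM2l ?normr_ge0 //; exact: IH.
  rewrite ler_wpM2r ?exprn_ge0 ?(ltW r0) // /C' mulrDr [_ * (D / _)]mulrC divfK ?gt_eqF //.
  by rewrite lerDr; apply: mulr_ge0; [exact: ltW | exact: addr_ge0].
rewrite !normrM normrX (ger0_norm q0) -mulrA ler_wpM2l //.
by rewrite -[leRHS]mul1r ler_pM ?exprn_ge0 // exprn_ile1.
Qed.

(** * Finite truncations *)

Definition sum_but_max (I : finType) (g : I -> nat) : nat :=
  (\sum_j g j - \max_j g j)%N.

(* The law of min(G, m) for a geometric G. *)
Definition truncated_weight (K : pzRingType) (q : K) (m i : nat) : K :=
  if (i < m)%N then (1 - q) * q ^+ i else q ^+ m.

Section SumButMax.
Variable I : finType.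
Implicit Types (g h : I -> nat) (S : {set I}).

Lemma sum_but_maxE g j0 : (forall j, (g j <= g j0)%N) ->
  sum_but_max g = (\sum_(j | j != j0) g j)%N.
Proof.
move=> hj0; rewrite /sum_but_max (bigD1 j0) //=.
suff -> : (\max_j g j = g j0)%N by rewrite addKn.
apply/eqP; rewrite eqn_leq; apply/andP; split; first exact/bigmax_leqP.
exact: (@leq_bigmax _ g j0).
Qed.

Lemma sum_but_max0 g : (forall j, g j = 0%N) -> sum_but_max g = 0%N.
Proof. by move=> g0; rewrite /sum_but_max big1. Qed.

(** An empty [I] has no argmax; the second alternative expresses emptiness in a form that closes any
    goal about an index. *)
Lemma argmax_or_void g :
  (exists j0, forall j, (g j <= g j0)%N) \/ (forall P : I -> Prop, forall j, P j).
Proof.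
case: (pickP (fun _ : I => true)) => [i _|none].
  by left; exists [arg max_(j > i) g j]; case: arg_maxnP => // j _ jP k; exact: jP.
by right=> P j; have := none j.
Qed.

(** An argmax of g is an argmax of all its truncations, so both sides are sums over the same
    remaining indices. *)
Lemma leq_sum_but_max_minn g m m' : (m <= m')%N ->
  (sum_but_max (fun j => minn (g j) m) <= sum_but_max (fun j => minn (g j) m'))%N.
Proof.
move=> mm'; have [[j0 hj0]|v] := argmax_or_void g; last first.
  by rewrite !sum_but_max0 //; exact: v.
rewrite !(@sum_but_maxE _ j0); try by move=> j; have := hj0 j; lia.
by apply: leq_sum => j _; lia.
Qed.

Lemma sum_but_max_minn_id g m : (\max_j g j <= m)%N ->
  sum_but_max (fun j => minn (g j) m) = sum_but_max g.
Proof.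
move=> gm; rewrite /sum_but_max.
have e j : minn (g j) m = g j.
  by apply/minn_idPl; apply: leq_trans gm; exact: (@leq_bigmax _ g).
by rewrite (eq_bigr _ (fun j _ => e j)) [X in (_ - X)%N](eq_bigr _ (fun j _ => e j)).
Qed.

(* Removing the first layer {j | 1 <= g j} = S from g leaves h. *)
Lemma sum_but_max_raise S (g h : I -> nat) :
  (forall j, g j = if j \in S then (h j).+1 else 0%N) ->
  (forall j, j \notin S -> h j = 0%N) ->
  sum_but_max g = (#|S| - 1 + sum_but_max h)%N.
Proof.
move=> gE h0; have [[j0 hj0]|v] := argmax_or_void h; last first.
  rewrite !sum_but_max0; try exact: v.
  by rewrite (_ : S = finset.set0) ?cards0 //; apply/finset.setP; apply: v.
have [S0|[j1 j1S]] := finset.set_0Vmem S.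
  rewrite S0 cards0 !sum_but_max0 // => j; first by rewrite h0 // S0 inE.
  by rewrite gE S0 inE.
(* An argmax of h inside S is also one of g. If the argmax at hand lies outside S, then h vanishes
   and any element of S serves. *)
have {j1 j1S} [j2 [hj2 j2S]] : exists j2, (forall j, (h j <= h j2)%N) /\ j2 \in S.
  have [j0S|j0S] := boolP (j0 \in S); first by exists j0.
  by exists j1; split=> // j; rewrite (leq_trans (hj0 j)) // h0.
rewrite (@sum_but_maxE h j2) // (@sum_but_maxE g j2); last first.
  by move=> j; rewrite !gE j2S; case: ifP => // _; rewrite ltnS.
rewrite (eq_bigr (fun j => (j \in S) + h j)%N); last first.
  by move=> j _; rewrite gE; case: ifPn => // /h0 ->.
rewrite big_split /=; congr (_ + _)%N.
rewrite (cardsD1 j2 S) j2S /= add1n subn1 /= -sum1_card big_mkcond [RHS]big_mkcond /=.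
by apply: eq_bigr => j _; rewrite !inE; case: (j == j2); case: (j \in S).
Qed.

End SumButMax.

(** * Truncated generating functions as iterates of the recurrence *)

Section TruncatedSum.
Variables (K : fieldType) (q t : K) (I : finType).
Implicit Type S : {set I}.

Definition supp (m : nat) (g : {ffun I -> 'I_m.+1}) : {set I} :=
  [set j | g j != ord0].

(** Variables outside S are set to 0 instead of being dropped, so that all S share one type of
    tuples. *)
Definition truncated_gf (m : nat) (S : {set I}) : K :=
  \sum_(g : {ffun I -> 'I_m.+1} | supp g \subset S)
    (\prod_(j in S) truncated_weight q m (g j)) * t ^+ sum_but_max (fun j => g j).

(** [raise S] maps the tuples supported within S bijectively onto those, one level higher, whose
    support is exactly S; [lower] is the inverse. *)
Definition raise (m : nat) (S : {set I}) (h : {ffun I -> 'I_m.+1}) :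
  {ffun I -> 'I_m.+2} := [ffun j => if j \in S then lift ord0 (h j) else ord0].

Definition lower (m : nat) (g : {ffun I -> 'I_m.+2}) : {ffun I -> 'I_m.+1} :=
  [ffun j => inord (g j).-1].

Lemma raise_lower m S g : supp g == S -> raise S (@lower m g) = g.
Proof.
move=> /eqP gS; apply/ffunP => j; rewrite !ffunE -gS inE; apply: val_inj => /=.
case: ifPn => [g0|]; last by rewrite negbK => /eqP ->.
have g0' : (0 < g j)%N by rewrite lt0n.
by rewrite /= inordK ?prednK ?leq_ord // /bump /= add1n prednK.
Qed.

Lemma supp_raise m S (h : {ffun I -> 'I_m.+1}) : supp (raise S h) = S.
Proof. by apply/finset.setP => j; rewrite inE ffunE; case: (j \in S). Qed.

Lemma lower_raise m S (h : {ffun I -> 'I_m.+1}) :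
  (lower (raise S h) == h) = (supp h \subset S).
Proof.
apply/eqP/fintype.subsetP => [e j|hS].
  rewrite inE -{1}e !ffunE; case: (j \in S) => //= /eqP[].
  by apply: val_inj; rewrite /= inordK.
apply/ffunP => j; rewrite !ffunE; case: ifPn => jS; apply: val_inj => /=.
  by rewrite /bump /= ?add0n inord_val.
rewrite inordK //; case: (eqVneq (h j) ord0) => [->//|h0].
by case/negP: jS; apply: hS; rewrite inE.
Qed.

Lemma sum_card_subset S (F : nat -> K) :
  \sum_(A : {set I} | A \subset S) F #|A| =
  \sum_(n < #|S|.+1) 'C(#|S|, n)%:R * F n.
Proof.
rewrite (partition_big (fun A : {set I} => inord #|A| : 'I_(#|S|.+1)) predT) //=.
apply: eq_bigr => n _.
transitivity (\sum_(A in [set A : {set I} | A \subset S & #|A| == n]) F n).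
  apply: eq_big => A.
    rewrite inE; case: (boolP (A \subset S)) => //= AS.
    by rewrite -val_eqE /= inordK // ltnS subset_leq_card.
  move=> /andP[AS /eqP <-]; rewrite inordK // ltnS subset_leq_card //.
by rewrite sumr_const cards_draws mulr_natl.
Qed.

(** The finite form of conditioning on N_1: group the tuples by their support A, strip one layer off
    A, and apply the induction hypothesis to A. Only the size of A matters in the end. *)
Lemma truncated_gf_iter m S :
  truncated_gf m S = iter m (gf_step q t) (fun=> 1) #|S|.
Proof.
elim: m S => [|m IH] S.
  rewrite /truncated_gf (big_pred1 [ffun=> ord0]) => [|g].
    rewrite sum_but_max0 => [|j]; last by rewrite ffunE.
    by rewrite mulr1 big1 // => j _; rewrite /truncated_weight ffunE expr0.
  have e j : g j = ord0 by exact: ord1.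
  transitivity true; first by apply/fintype.subsetP => j; rewrite inE e eqxx.
  by apply/esym/eqP/ffunP => j; rewrite ffunE e.
rewrite iterS; set f := iter m _ _ in IH *.
rewrite /truncated_gf (partition_big (@supp m.+1) (fun A => A \subset S)) //=.
pose F n := (1 - q) ^+ (#|S| - n) * q ^+ n * t ^+ (n - 1) * f n.
transitivity (\sum_(A : {set I} | A \subset S) F #|A|).
  apply: eq_bigr => A AS.
  rewrite (reindex_onto (raise A) (@lower m)) /=; last first.
    by move=> g /andP[_ gA]; exact: raise_lower.
  rewrite /F -IH /truncated_gf mulr_sumr; apply: eq_big => [h|h hP].
    by rewrite supp_raise AS eqxx lower_raise.
  have {hP} hA : supp h \subset A.
    by move: hP; rewrite lower_raise => /andP[_ ->].
  have hE j : (raise A h j = (if j \in A then (h j).+1 else 0) :> nat)%N.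
    by rewrite ffunE; case: ifP.
  rewrite (@sum_but_max_raise _ A _ (fun j => h j) hE); last first.
    move=> j jA; apply/eqP; apply: contraNT jA => hj; apply: (fintype.subsetP hA).
    by rewrite inE.
  rewrite exprD.
  have -> : \prod_(j in S) truncated_weight q m.+1 (raise A h j) =
      (1 - q) ^+ (#|S| - #|A|) *
      (q ^+ #|A| * \prod_(j in A) truncated_weight q m (h j)).
    rewrite (bigID (mem A)) /= mulrC; congr (_ * _).
      rewrite -cardsDS // -prodr_const; apply: eq_big => j.
        by rewrite !inE andbC.
      by move=> /andP[_ jA]; rewrite hE (negPf jA) /truncated_weight /= expr0 mulr1.
    rewrite -prodr_const -big_split /=; apply: eq_big => j.
      by rewrite andbC; case: (boolP (j \in A)) => // /(fintype.subsetP AS) ->.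
    (* Memorylessness: the weight of i + 1 at level m + 1 is q times the weight of i at level m. *)
    move=> /andP[_ jA]; rewrite hE jA /truncated_weight ltnS.
    by case: ifP => _; rewrite exprS // mulrCA.
  by ring.
rewrite sum_card_subset big_ord_recl /= bin0 /F /gf_step big_add1 big_mkord /=.
congr (_ + _).
  (* Empty support: every iterate is 1 at index 0, and the exponent 0 - 1 truncates to the correct
     value 0. *)
  have -> : f 0%N = 1.
    by rewrite /f; case: m {IH f F} => //= m; rewrite /gf_step big_geq // addr0 expr0.
  by rewrite subn0 expr0 !mulr1 mul1r.
by apply: eq_bigr => j _; rewrite /bump /= add1n; ring.
Qed.

End TruncatedSum.

(** * Convergence of the truncated expectations *)

Lemma cvg_geometric_rate (R : realType) (u : nat -> R) (l a c r : R) :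
  0 <= r < 1 -> (forall m, `|u m - a| <= c * r ^+ m) ->
  u m @[m --> \oo] --> l -> l = a.
Proof.
move=> /andP[r0 r1] h ul; apply: (cvg_unique _ ul) => //.
apply/cvgrPdist_le => e e0.
have : (fun m => c * r ^+ m) @ \oo --> c * 0.
  by apply: cvgM; [exact: cvg_cst|apply: cvg_expr; rewrite ger0_norm].
rewrite mulr0 => /cvgr0_norm_le /(_ e e0); apply: filterS => m hm.
by rewrite distrC; apply: le_trans (h m) _; apply: le_trans hm; exact: ler_norm.
Qed.

Section Geometric.
Context d (T : measurableType d) (R : realType) (P : probability T R) (p : nat).

(** Induction by P(X >= m+1) = P(X >= m) - P(X = m), without summing a series. *)
Lemma geometric_tail (X : {RV P >-> nat}) m : Defs.geometric p X ->
  P (X @^-1` [set i | (m <= i)%N]) = ((1 / p%:R) ^+ m)%:E.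
Proof.
move=> gX; elim: m => [|m IH].
  rewrite expr0 (_ : _ @^-1` _ = setT) ?probability_setT //.
  by apply/seteqP; split.
have e : [set i | (m <= i)%N] = [set m] `|` [set i | (m.+1 <= i)%N].
  apply/seteqP; split=> i /=; first by rewrite leq_eqVlt => /orP[/eqP->|]; [left|right].
  by case=> [->|/ltnW].
move: IH; rewrite e preimage_setU measureU //=; last 3 first.
- by rewrite -[X in measurable X]setTI; exact: measurable_funP.
- by rewrite -[X in measurable X]setTI; exact: measurable_funP.
- by apply/seteqP; split=> // w /= [->]; rewrite ltnn.
rewrite gX => h.
have -> : (((1 / p%:R) ^+ m.+1)%:E = ((1 / p%:R) ^+ m)%:E -
   ((1 - 1 / p%:R) * (1 / p%:R ^+ m))%:E :> \bar R)%E.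
  by rewrite -EFinB exprS !div1r exprVn; congr (_%:E); ring.
by rewrite -h addeAC subee // add0e.
Qed.

Lemma geometric_minn (X : {RV P >-> nat}) m n : Defs.geometric p X -> (n <= m)%N ->
  P (X @^-1` [set i | minn i m = n]) = (truncated_weight (1 / p%:R) m n)%:E.
Proof.
move=> gX nm; rewrite /truncated_weight; case: ifPn => [nm'|].
  rewrite (_ : [set i | _] = [set n]) ?gX; last by apply/seteqP; split => i /=; lia.
  by rewrite !div1r exprVn.
rewrite -leqNgt => mn; rewrite -(geometric_tail _ gX); congr (P (_ @^-1` _)).
by apply/seteqP; split => i /=; lia.
Qed.

Variables (k : nat) (G : 'I_k -> {RV P >-> nat}).
Hypothesis iidG : iid_geometric p G.

Definition truncated_tuple m w : {ffun 'I_k -> 'I_m.+1} :=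
  [ffun j => inord (minn (G j w) m)].

Lemma truncated_tupleE m w j : truncated_tuple m w j = minn (G j w) m :> nat.
Proof. by rewrite ffunE inordK // ltnS geq_minr. Qed.

Lemma truncated_tuple_preimage m g : [set w | truncated_tuple m w = g] =
  \bigcap_(j in [set j | j \in [set: 'I_k]%SET])
     (G j @^-1` [set i | minn i m = g j]).
Proof.
apply/seteqP; split => w /=; first by move=> <- j _ /=; rewrite truncated_tupleE.
move=> h; apply/ffunP => j; apply: val_inj; rewrite /= truncated_tupleE.
by apply: h; rewrite /= inE.
Qed.

Lemma measurable_truncated_tuple m g :
  measurable [set w | truncated_tuple m w = g].
Proof.
rewrite truncated_tuple_preimage; apply: fin_bigcap_measurable => // j _.
by rewrite -[X in measurable X]setTI; exact: measurable_funP.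
Qed.

Lemma prob_truncated_tuple m g : P [set w | truncated_tuple m w = g] =
  (\prod_j truncated_weight (1 / p%:R) m (g j))%:E.
Proof.
have [ind geo] := iidG.
rewrite truncated_tuple_preimage (ind [set: 'I_k]%SET (fun j => [set i | minn i m = g j])) //.
rewrite (big_morph _ (@EFinM R) erefl); apply: eq_big => j; first by rewrite inE.
by move=> _; apply: geometric_minn => //; rewrite -ltnS.
Qed.

(** The expectation of [phi (truncated_Z m w)] as a finite sum. [phi] will be z |-> p^z and the real
    and imaginary parts of z |-> t^z. *)
Definition truncated_sum (phi : nat -> R) m : R :=
  \sum_(g : {ffun 'I_k -> 'I_m.+1})
    (\prod_j truncated_weight (1 / p%:R) m (g j)) * phi (sum_but_max (fun j => g j)).

Definition truncated_Z m w := sum_but_max (fun j => minn (G j w) m).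

(** A simple-function decomposition, from which both measurability and the integral follow. *)
Lemma truncated_Z_indic (phi : nat -> R) m w :
  phi (truncated_Z m w) = \sum_(g : {ffun 'I_k -> 'I_m.+1})
    phi (sum_but_max (fun j => g j)) * \1_[set w | truncated_tuple m w = g] w.
Proof.
rewrite (bigD1 (truncated_tuple m w)) //= big1 ?addr0 => [|g gw].
  rewrite indicE mem_set //= mulr1; congr (phi _); rewrite /truncated_Z.
  by congr sum_but_max; apply/funext => j; rewrite truncated_tupleE.
by rewrite indicE memNset ?mulr0 //= => e; rewrite e eqxx in gw.
Qed.

Lemma leq_truncated_Z m w : (truncated_Z m w <= Zk G w)%N.
Proof.
rewrite -[Zk G w](@sum_but_max_minn_id _ _ (maxn m (\max_j G j w))) ?leq_maxr //.
by apply: leq_sum_but_max_minn; exact: leq_maxl.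
Qed.

Lemma measurable_truncated_Z (phi : nat -> R) m :
  measurable_fun [set: T] (fun w => phi (truncated_Z m w)).
Proof.
under eq_fun do rewrite truncated_Z_indic.
apply: measurable_sum => g; apply: measurable_funM => //.
by apply: measurable_indic; exact: measurable_truncated_tuple.
Qed.

Lemma integral_truncated_Z (phi : nat -> R) m :
  (\int[P]_w (phi (truncated_Z m w))%:E = (truncated_sum phi m)%:E)%E.
Proof.
under eq_integral do rewrite truncated_Z_indic -sumEFin.
rewrite integral_sum //; last first.
  move=> g; under eq_fun do rewrite EFinM.
  by apply: integrableZl => //; apply: integrable_indic; exact: measurable_truncated_tuple.
rewrite /truncated_sum -sumEFin; apply: eq_bigr => g _.
under eq_integral do rewrite EFinM.
rewrite integralZl //; last first.
  by apply: integrable_indic; exact: measurable_truncated_tuple.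
rewrite integral_indic ?setIT //; last exact: measurable_truncated_tuple.
rewrite [X in (_ * X)%E](_ : _ = (\prod_j truncated_weight (1 / p%:R) m (g j))%:E).
  by rewrite -EFinM mulrC.
exact: prob_truncated_tuple.
Qed.

(** The sequence is constant once m reaches the maximum of the [G j w], so [phi] may be
    arbitrary. *)
Lemma cvg_truncated_Z (phi : nat -> R) w :
  phi (truncated_Z m w) @[m --> \oo] --> phi (Zk G w).
Proof.
apply: cvg_near_cst => //.
near=> m; rewrite /truncated_Z sum_but_max_minn_id //.
by near: m; exact: nbhs_infty_ge.
Unshelve. all: by end_near. Qed.

Lemma measurable_Zk (phi : nat -> R) :
  measurable_fun [set: T] (fun w => phi (Zk G w)).
Proof.
apply: (@measurable_fun_cvg _ _ _ _ (fun m w => phi (truncated_Z m w))) => //.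
  by move=> m; exact: measurable_truncated_Z.
by move=> w _; exact: cvg_truncated_Z.
Qed.

(** Monotone convergence: [truncated_Z m] increases with m to [Zk], and [M] bounds all the
    integrals. *)
Lemma integrable_Zk_of_bounded (b : nat -> R) (M : R) :
  (forall z, 0 <= b z) -> {homo b : x y / (x <= y)%N >-> x <= y} ->
  (forall m, truncated_sum b m <= M) ->
  P.-integrable [set: T] (fun w => (b (Zk G w))%:E).
Proof.
move=> b0 bh bM; apply/integrableP; split.
  by apply/measurable_EFinP; exact: measurable_Zk.
have := @cvg_monotone_convergence _ _ _ P _ measurableT
  (fun m w => (b (truncated_Z m w))%:E).
move=> /(_ _ _ _)/wrap[].
  by move=> m; apply/measurable_EFinP; exact: measurable_truncated_Z.
  by move=> m w _; rewrite lee_fin.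
  move=> w _ m m' mm'; rewrite lee_fin; apply: bh.
  exact: leq_sum_but_max_minn.
under eq_integral => w _.
  rewrite (cvg_lim _ (_ : (b (truncated_Z m w))%:E @[m --> \oo] --> (b (Zk G w))%:E)) //; last first.
    by apply: cvg_EFin; [exact: nearW|exact: cvg_truncated_Z].
  over.
move=> h; under eq_integral do rewrite gee0_abs ?lee_fin //.
apply: (@le_lt_trans _ _ M%:E); last by rewrite ltry.
rewrite -(cvg_lim _ h) //; apply: lime_le; first by apply/cvg_ex; eexists; exact: h.
by apply: nearW => m; rewrite integral_truncated_Z lee_fin.
Qed.

Lemma dominated_Zk (b phi : nat -> R) :
  P.-integrable [set: T] (fun w => (b (Zk G w))%:E) ->
  {homo b : x y / (x <= y)%N >-> x <= y} ->
  (forall z, `|phi z| <= b z) ->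
  P.-integrable [set: T] (fun w => (phi (Zk G w))%:E) /\
  truncated_sum phi m @[m --> \oo] --> fine (\int[P]_w (phi (Zk G w))%:E)%E.
Proof.
move=> ib bh phib.
have [|||||i _ c] := @dominated_convergence _ _ _ P _ measurableT
  (fun m w => (phi (truncated_Z m w))%:E) (fun w => (phi (Zk G w))%:E)
  (fun w => (b (Zk G w))%:E) => //.
- by move=> m; apply/measurable_EFinP; exact: measurable_truncated_Z.
- by apply/measurable_EFinP; exact: measurable_Zk.
- by apply: nearW => w _; apply: cvg_EFin; [exact: nearW|exact: cvg_truncated_Z].
- apply: nearW => w m _; rewrite abse_EFin lee_fin.
  by apply: le_trans (phib _) (bh _ _ _); exact: leq_truncated_Z.
split => //.
have {}c : (truncated_sum phi m)%:E @[m --> \oo] -->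
    (fine (\int[P]_w (phi (Zk G w))%:E)%E)%:E.
  rewrite fineK; last exact: integrable_fin_num.
  by move: c; under eq_fun do rewrite integral_truncated_Z.
exact: (fine_cvg c).
Qed.

End Geometric.

(** * Generating functions *)

(** 3/4 serves as the rate r of [gf_iter_cvg] for every p: it lies strictly between 1/2 >= 1/p and
    1. *)
Lemma three_quarters_itv (K : numFieldType) : 0 <= (3 / 4 : K) < 1.
Proof. by rewrite divr_ge0 // ltr_pdivrMr // mul1r ltr_nat. Qed.

Section NumField.
Variables (K : numFieldType) (p : nat).
Hypothesis p1 : (1 < p)%N.

Lemma inv_p_bounds : 0 <= 1 / p%:R :> K /\ 1 / p%:R < 3 / 4 :> K.
Proof.
have p2 : 2 <= p%:R :> K by rewrite ler_nat.
have p0 : 0 < p%:R :> K by apply: lt_le_trans p2.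
split; first by rewrite divr_ge0 // ltW.
rewrite ltr_pdivrMr // (@lt_le_trans _ _ (3 / 4 * 2)) //.
  by rewrite mulrAC ltr_pdivlMr // mul1r -natrM ltr_nat.
by rewrite ler_wpM2l.
Qed.

Lemma ler_norm_inv_p (t : K) : `|t| <= p%:R -> `|1 / p%:R * t| <= 1.
Proof.
have p0 : 0 < p%:R :> K by rewrite ltr0n ltnW.
by move=> tp; rewrite div1r mulrC normrM normfV normr_nat ler_pdivrMr ?mul1r.
Qed.

(** The coefficient is q (q t)^(j-1) with |q t| <= 1, so its norm is at most q < 1; hence no pole
    lies in the closed disc. *)
Lemma norm_gf_coef_lt1 (t : K) j : `|t| <= p%:R -> (0 < j)%N ->
  `|(1 / p%:R) ^+ j * t ^+ (j - 1)| < 1.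
Proof.
move=> tp; case: j => // j _; have [q0 q1] := inv_p_bounds.
rewrite subn1 /= exprS -mulrA -exprMn normrM normrX (ger0_norm q0).
have x1 : `|1 / p%:R * t| ^+ j <= 1 by rewrite exprn_ile1 // ler_norm_inv_p.
apply: le_lt_trans (_ : 1 / p%:R < 1); first by rewrite ler_piMr.
by apply: lt_trans q1 _; rewrite ltr_pdivrMr // mul1r ltr_nat.
Qed.

Lemma subr_gf_coef_neq0 (t : K) j : `|t| <= p%:R -> (0 < j)%N ->
  1 - (1 / p%:R) ^+ j * t ^+ (j - 1) != 0.
Proof.
move=> tp j0; rewrite subr_eq0.
by apply: contraTneq (norm_gf_coef_lt1 tp j0) => <-; rewrite normr1 ltxx.
Qed.

Lemma subr_inv_p_neq0 : 1 - 1 / p%:R != 0 :> K.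
Proof.
have [_ h] := inv_p_bounds; have /andP[_ h'] := three_quarters_itv K.
by rewrite subr_eq0 eq_sym lt_eqF // (lt_trans h).
Qed.

Lemma gf_den_unit (t : K) k : `|t| <= p%:R -> (gf_den k (1 / p%:R)).[t] != 0.
Proof.
move=> tp; apply/gf_den_neq0 => j /andP[j0 _].
by have := subr_gf_coef_neq0 tp j0; rewrite subr_eq0 eq_sym.
Qed.

End NumField.

Lemma rmorph_truncated_weight (K L : pzRingType) (f : {rmorphism K -> L}) q m i :
  f (truncated_weight q m i) = truncated_weight (f q) m i.
Proof.
by rewrite /truncated_weight; case: ifP; rewrite ?rmorphM ?rmorphB ?rmorphXn ?rmorph1.
Qed.

Lemma truncated_gfT (K : fieldType) (q t : K) k m :
  \sum_(g : {ffun 'I_k -> 'I_m.+1}) (\prod_j truncated_weight q m (g j)) *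
    t ^+ sum_but_max (fun j => g j) = iter m (gf_step q t) (fun=> 1) k.
Proof.
rewrite -[in RHS](card_ord k) -cardsT -truncated_gf_iter.
apply: eq_big => g; first by rewrite finset.subsetT.
by move=> _; congr (_ * _); apply: eq_bigl => j; rewrite finset.in_setT.
Qed.

Section GenFun.
Context d (T : measurableType d) (R : realType) (P : probability T R) (p : nat).
Hypothesis p1 : (1 < p)%N.
Variables (k : nat) (G : 'I_k -> {RV P >-> nat}).
Hypotheses (k0 : (0 < k)%N) (iidG : iid_geometric p G).

Lemma integrable_p_Zk : P.-integrable [set: T] (fun w => (p%:R ^+ Zk G w)%:E).
Proof.
have [q0 q1] := @inv_p_bounds R p p1.
have pp : `|p%:R : R| <= p%:R by rewrite normr_nat.
have [A /(_ p%:R (gf_den_unit p1 k pp))] := gf_fixpoint_rational (1 / p%:R : R) k.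
set F := fun n => _ => FF.
have [C C0 bnd] := gf_iter_cvg q0 q1 (ler_norm_inv_p p1 pp) FF.
have p1R : 1 <= p%:R :> R by rewrite ler1n ltnW.
(* The iterates at t = p lie within C (3/4)^m <= C of their limit [F k]. *)
apply: (@integrable_Zk_of_bounded _ _ _ _ _ _ _ iidG (fun z => p%:R ^+ z) (`|F k| + C)).
- by move=> z; rewrite exprn_ge0.
- by move=> x y xy; rewrite ler_weXn2l.
move=> m; rewrite /truncated_sum truncated_gfT.
have := bnd m k; rewrite k0 leqnn => /(_ isT) h.
have : C * (3 / 4) ^+ m <= C.
  have [r0 /ltW r1] := andP (@three_quarters_itv R).
  by rewrite ler_piMr // exprn_ile1.
move=> rC; apply: le_trans (ler_norm _) _.
rewrite -[X in `|X|](subrK (F k)) addrC; apply: le_trans (ler_normD _ _) _.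
by rewrite lerD2l; exact: le_trans h rC.
Qed.

(** [L] stands for the real or the imaginary part. Being real-linear, it commutes with the truncated
    sums, whose weights are real; dominated convergence and the geometric rate then give two limits
    of one sequence. *)
Lemma expectation_part (L : R[i] -> R) (t : R[i]) (F : nat -> R[i]) :
  {morph L : x y / x + y} -> (forall a x, L (a%:C * x) = a * L x) ->
  (forall x, `|L x|%:C <= `|x|) -> `|t| <= p%:R ->
  gf_fixpoint (1 / p%:R) t k F ->
  P.-integrable [set: T] (fun w => (L (t ^+ Zk G w))%:E) /\
  fine (\int[P]_w (L (t ^+ Zk G w))%:E)%E = L (F k).
Proof.
move=> LD LZ Ln tp FF.
have [q0 q1] := @inv_p_bounds R[i] p p1.
have [C C0 bnd] := gf_iter_cvg q0 q1 (ler_norm_inv_p p1 tp) FF.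
have p1R : 1 <= p%:R :> R by rewrite ler1n ltnW.
have [||i c] := dominated_Zk iidG (phi := fun z => L (t ^+ z)) integrable_p_Zk.
- by move=> x y xy; rewrite ler_weXn2l.
- move=> z; rewrite -lecR; apply: le_trans (Ln _) _.
  by rewrite rmorphXn rmorph_nat normrX lerXn2r ?nnegrE.
split=> //.
(* In [R[i]], 0 <= C forces C to be real, so the complex bound transfers to [R]. *)
have CE : C = (complex.Re C)%:C by rewrite RRe_real // ger0_real.
apply: (@cvg_geometric_rate _ _ _ _ (complex.Re C) (3 / 4) _ _ c).
  exact: three_quarters_itv.
move=> m; rewrite -lecR rmorphM rmorphXn /= -CE.
have -> : ((3 / 4 : R)%:C = 3 / 4 :> R[i]) by rewrite fmorph_div !rmorph_nat.
have L0 : L 0 = 0 by have := LZ 0 0; rewrite mulr0 mul0r.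
have LB x y : L x - L y = L (x - y).
  apply/eqP; rewrite subr_eq -LD subrK //.
have -> : truncated_sum p k (fun z => L (t ^+ z)) m =
    L (iter m (gf_step (1 / p%:R) t) (fun=> 1) k).
  rewrite -truncated_gfT (big_morph L LD L0); apply: eq_bigr => g _.
  rewrite -LZ rmorph_prod; congr (L (_ * _)); apply: eq_bigr => j _.
  by rewrite /= rmorph_truncated_weight fmorph_div rmorph1 rmorph_nat.
rewrite LB; apply: le_trans (Ln _) _; apply: bnd.
by rewrite k0 /=.
Qed.

Lemma genfun_fixpoint (t : R[i]) (F : nat -> R[i]) : `|t| <= p%:R ->
  gf_fixpoint (1 / p%:R) t k F ->
  Cintegrable P (fun w => t ^+ Zk G w) /\ genfun P (Zk G) t = F k.
Proof.
move=> tp FF.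
have [|||i1 e1] := @expectation_part (@complex.Re R) t F _ _ _ tp FF.
- by move=> [a b] [a' b'].
- by move=> a [x y] /=; rewrite mul0r subr0.
- exact: normc_ge_Re.
have [|||i2 e2] := @expectation_part (@complex.Im R) t F _ _ _ tp FF.
- by move=> [a b] [a' b'].
- by move=> a [x y] /=; rewrite mul0r addr0.
(* Since Re(i x) = - Im x, the bound for Re yields the one for Im. *)
- move=> x; have := normc_ge_Re (x * 'i%C).
  by rewrite ReiNIm normrN normrM complexiE normCi mulr1.
split; first by split.
by rewrite /genfun /Cexpectation unlock e1 e2; case: (F k).
Qed.

End GenFun.

(** * The closed formula and its continuous extension *)

Lemma Zgf_formulaE (R : realType) p k (t : R[i]) :
  Zgf_formula p k t = gf_closed (1 / p%:R) t k.
Proof.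
rewrite /Zgf_formula /gf_closed; congr (_ ^+ _ * _ ^- _ * _).
  by rewrite div1r mulrC.
apply: eq_bigr => j _; congr (_ * ((1 - _ ^+ _) / (1 - _))).
  by rewrite div1r mulrC.
by rewrite div1r exprVn mulrC.
Qed.

Lemma gf_fixpoint2_p (K : numFieldType) p k (t : K) f : (1 < p)%N ->
  `|t| <= p%:R -> (1 < k)%N -> gf_fixpoint (1 / p%:R) t k f ->
  f 2%N = (1 - 1 / p%:R ^+ 2) / (1 - t / p%:R ^+ 2).
Proof.
move=> p1 tp k1 ff.
rewrite (gf_fixpoint2 k1 (subr_inv_p_neq0 K p1) (@subr_gf_coef_neq0 _ _ p1 _ 2 tp isT) ff).
by rewrite !div1r exprVn [_^-1 * t]mulrC.
Qed.

Lemma gf_fixpoint3_p (K : numFieldType) p k (t : K) f : (1 < p)%N ->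
  `|t| <= p%:R -> (2 < k)%N -> gf_fixpoint (1 / p%:R) t k f ->
  f 3%N = (1 - 1 / p%:R) ^+ 2 /
      ((1 - t / p%:R ^+ 2) * (1 - t ^+ 2 / p%:R ^+ 3)) *
    (1 + 2 / p%:R + 2 * t / p%:R ^+ 2 + t / p%:R ^+ 3).
Proof.
move=> p1 tp k2 ff.
rewrite (gf_fixpoint3 k2 (subr_inv_p_neq0 K p1) (@subr_gf_coef_neq0 _ _ p1 _ 2 tp isT)
  (@subr_gf_coef_neq0 _ _ p1 _ 3 tp isT) ff).
rewrite !div1r !exprVn; congr (_ / ((1 - _) * (1 - _)) * (_ + _)).
- by rewrite mulrC.
- by rewrite mulrC.
- by rewrite -mulrA [_^-1 * t]mulrC mulrA.
- by rewrite mulrC.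
Qed.

Lemma cvg_horner (K : numFieldType) (U : Type) (F : set_system U)
    {FF : Filter F} (A : {poly K}) (f : U -> K) (a : K) :
  f x @[x --> F] --> a -> A.[f x] @[x --> F] --> A.[a].
Proof.
move=> fa; elim/poly_ind: A => [|A c IH].
  by rewrite horner0; under eq_fun do rewrite horner0; exact: cvg_cst.
rewrite hornerMXaddC; under eq_fun do rewrite hornerMXaddC.
by apply: cvgD; [exact: cvgM | exact: cvg_cst].
Qed.

(** By continuity B stays nonzero near a, so g coincides there with A / B off a; its own value at a
    is irrelevant. *)
Lemma cvg_rational_extension (K : numFieldType) (A B : {poly K}) (a : K)
    (g : K -> K) : B.[a] != 0 ->
  (forall x, x != a -> B.[x] != 0 -> g x = A.[x] / B.[x]) ->
  g x @[x --> a^'] --> A.[a] / B.[a].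
Proof.
move=> Ba gE.
have xa : x @[x --> a^'] --> a by exact: nbhs_dnbhs.
have Bx : B.[x] @[x --> a^'] --> B.[a] by exact: cvg_horner.
have : A.[x] / B.[x] @[x --> a^'] --> A.[a] / B.[a].
  by apply: cvgM; [exact: cvg_horner | exact: cvgV].
apply: cvg_trans; apply: near_eq_cvg.
have B0 : \forall x \near a^', B.[x] != 0 by exact: (cvgr_neq0 _ Bx).
near=> x; rewrite gE //; last by near: x.
by near: x; exact: nbhs_dnbhs_neq.
Unshelve. all: by end_near. Qed.

(** The hypothesis is a nonzero denominator rather than |t| <= p, since the limit at p also runs
    through points outside the disc. *)
Lemma gf_closed_rational (K : numFieldType) p k (t : K) f : (1 < p)%N ->
  (0 < k)%N -> t != p%:R -> (gf_den k (1 / p%:R)).[t] != 0 ->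
  gf_fixpoint (1 / p%:R) t k f -> gf_closed (1 / p%:R) t k = f k.
Proof.
move=> p1 k0 tp d0 ff.
have p0 : p%:R != 0 :> K by rewrite pnatr_eq0 -lt0n ltnW.
have x1 : 1 - 1 / p%:R * t != 0.
  apply: contraNneq tp => /eqP; rewrite subr_eq0 div1r => /eqP e.
  by rewrite -[t](mulVKf p0) -e mulr1.
have qt1 := (gf_den_neq0 _ _ _).1 d0.
apply: (gf_fixpoint_unique qt1 _ ff); last by rewrite k0 /=.
exact: (gf_closed_fixpoint (subr_inv_p_neq0 K p1) x1 qt1).
Qed.

Theorem proposition2p6 (d : measure_display) (T : measurableType d)
    (R : realType) (P : probability T R) (p : nat) (p_prime : prime p) :
  (forall (k : nat) (G : 'I_k -> {RV P >-> nat}),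
     (0 < k)%N -> iid_geometric p G ->
     [/\ (forall t : R[i], `|t| <= p%:R ->
            Cintegrable P (fun w => t ^+ Zk G w)),
         (exists A B : {poly R[i]}, forall t : R[i], `|t| <= p%:R ->
            B.[t] != 0 /\ genfun P (Zk G) t = A.[t] / B.[t]),
         (forall t : R[i], `|t| <= p%:R -> t != p%:R ->
            genfun P (Zk G) t = Zgf_formula p k t)
       & ((fun t : (R[i])^o => Zgf_formula p k t : (R[i])^o)
            @ (p%:R : (R[i])^o)^' --> (genfun P (Zk G) p%:R : (R[i])^o))])
  /\ (forall G : 'I_1 -> {RV P >-> nat}, iid_geometric p G ->
        forall t : R[i], `|t| <= p%:R -> genfun P (Zk G) t = 1)
  /\ (forall G : 'I_2 -> {RV P >-> nat}, iid_geometric p G ->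
        forall t : R[i], `|t| <= p%:R ->
          genfun P (Zk G) t =
            genfun P (fun w => minn (G ord0 w) (G ord_max w)) t /\
          genfun P (fun w => minn (G ord0 w) (G ord_max w)) t =
            (1 - 1 / p%:R ^+ 2) / (1 - t / p%:R ^+ 2))
  /\ (forall G : 'I_3 -> {RV P >-> nat}, iid_geometric p G ->
        forall t : R[i], `|t| <= p%:R ->
          genfun P (Zk G) t =
            (1 - 1 / p%:R) ^+ 2 /
              ((1 - t / p%:R ^+ 2) * (1 - t ^+ 2 / p%:R ^+ 3)) *
            (1 + 2 / p%:R + 2 * t / p%:R ^+ 2 + t / p%:R ^+ 3)).
Proof.
have p1 := prime_gt1 p_prime.
have [A FA] := choice (gf_fixpoint_rational (1 / p%:R : R[i])).
pose F k t n := (A k n).[t] / (gf_den n (1 / p%:R)).[t].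
have Ffix k (t : R[i]) (tp : `|t| <= p%:R) : gf_fixpoint (1 / p%:R) t k (F k t).
  exact: FA (gf_den_unit p1 k tp).
have genE k (G : 'I_k -> {RV P >-> nat}) (k0 : (0 < k)%N)
    (iidG : iid_geometric p G) (t : R[i]) (tp : `|t| <= p%:R) :=
  genfun_fixpoint p1 k0 iidG tp (Ffix k t tp).
have closedE k (t : R[i]) : (0 < k)%N -> t != p%:R ->
    (gf_den k (1 / p%:R)).[t] != 0 -> Zgf_formula p k t = F k t k.
  move=> k0 tp d0; rewrite Zgf_formulaE.
  exact: (gf_closed_rational p1 k0 tp d0 (FA k t d0)).
split; [|split; [|split]].
- move=> k G k0 iidG; split.
  + by move=> t tp; have [] := genE k G k0 iidG t tp.
  + exists (A k k), (gf_den k (1 / p%:R)) => t tp.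
    by split; [exact: gf_den_unit | have [] := genE k G k0 iidG t tp].
  + move=> t tp tNp; have [_ ->] := genE k G k0 iidG t tp.
    by rewrite closedE //; exact: gf_den_unit.
  + have pp : `|p%:R : R[i]| <= p%:R by rewrite normr_nat.
    have [_ ->] := genE k G k0 iidG p%:R pp.
    apply: (cvg_rational_extension (gf_den_unit p1 k pp)) => t.
    exact: closedE.
- move=> G iidG t tp; have [_ ->] := genE _ G isT iidG t tp.
  by apply: (gf_fixpoint1 _ (subr_inv_p_neq0 _ p1) (Ffix 1%N t tp)).
- move=> G iidG t tp; have [_ e] := genE _ G isT iidG t tp.
  (* For two variables, sum minus maximum is pointwise the minimum. *)
  have -> : (fun w => minn (G ord0 w) (G ord_max w)) = Zk G.
    apply/funext => w; rewrite /Zk !big_ord_recl !big_ord0.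
    rewrite (_ : lift ord0 ord0 = ord_max); last exact: val_inj.
    by rewrite maxn0 addn0; lia.
  by split=> //; rewrite e; apply: (gf_fixpoint2_p p1 tp _ (Ffix 2%N t tp)).
- move=> G iidG t tp; have [_ ->] := genE _ G isT iidG t tp.
  by apply: (gf_fixpoint3_p p1 tp _ (Ffix 3%N t tp)).
Qed.
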